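(* Let $\mathcal T(\bar f,\bar p,J)$ be an iterated function scheme of uniformly contracting $C^{1+\varepsilon}$ diffeomorphisms and let $\mu$ be its stationary measure. Assume that for some $\alpha>0$ there exist $r>0$ and a function $\psi:\mathbb R\to[0,\infty)$ which vanishes outside $B_r(J)$ and which on $B_r(J)$ is positive and bounded away from $0$ and from infinity, such that $$[\mathcal D^{(1)}_{\alpha,\mathcal T}\psi](x)<\psi(x)\qquad\text{for all } x\in B_r(J).$$ Then $\mu$ is $\alpha$-regular, i.e. there exists a constant $C$ such that $\mu(B_\rho(x))<C\rho^\alpha$ for every $\rho>0$ and every $x\in\mathbb R$.
   Context: An iterated function scheme $\mathcal T(\bar f,\bar p,J)$ consists of a compact interval $J\subset\mathbb R$, a finite collection $\bar f=(f_1,\dots,f_n)$ of uniformly contracting $C^{1+\varepsilon}$ diffeomorphisms of $\mathbb R$ (for some $\varepsilon>0$; i.e. each $f_j'$ is Hölder continuous of exponent $\varepsilon$, and there is a constant $\theta<1$ with $|f_j'|\le\theta$ for all $j$) with $f_j(J)\subset J$ for all $j$, and a probability vector $\bar p=(p_1,\dots,p_n)$. Its stationary measure is the unique Borel probability measure $\mu$ with $\mu=\sum_{j=1}^n p_j (f_j)_*\mu$. $B_\rho(x)$ is the neighbourhood of radius $\rho$ of the point $x$, and $B_r(J)$ is the closed neighbourhood of radius $r$ of the interval $J$. The asymmetric diffusion operator acts on functions $\psi:\mathbb R\to\mathbb R$ by $$[\mathcal D^{(1)}_{\alpha,\mathcal T}\psi](x)=\sum_{j=1}^n p_j\,|(f_j^{-1})'(x)|^\alpha\,\psi(f_j^{-1}(x)).$$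 *)

(* Defs.v *)
From mathcomp Require Import all_boot all_order all_algebra.
From mathcomp Require Import all_classical all_reals all_analysis.

Set Implicit Arguments.
Unset Strict Implicit.
Unset Printing Implicit Defensive.

Import Order.TTheory GRing.Theory Num.Theory.
Import numFieldNormedType.Exports.

Local Open Scope classical_set_scope.
Local Open Scope ring_scope.

Definition is_C1 (R : realType) (f : R -> R) : Prop :=
  (forall x, derivable f x 1) /\ continuous (derive1 f).

Definition is_hoelder (R : realType) (eps : R) (h : R -> R) : Prop :=
  exists K : R, forall x y, `|h x - h y| <= K * `|x - y| `^ eps.

(* The inverse g is a separate argument, determined by f through the two
   cancellation conditions. *)
Definition is_C1_diffeo (R : realType) (f g : R -> R) : Prop :=
  [/\ cancel f g, cancel g f, is_C1 f & is_C1 g].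

(* The probability vector may have zero entries; that there is at least one
   map follows from ifs_prob_sum1. *)
Record ifs (R : realType) := Ifs {
  ifs_size : nat;
  ifs_lo : R;
  ifs_hi : R;
  ifs_map : 'I_ifs_size -> R -> R;
  ifs_inv : 'I_ifs_size -> R -> R;
  ifs_prob : 'I_ifs_size -> R;
  ifs_lo_hi : ifs_lo <= ifs_hi;
  ifs_diffeo : forall j, is_C1_diffeo (ifs_map j) (ifs_inv j);
  ifs_hoelder : exists2 eps : R, 0 < eps &
    forall j, is_hoelder eps (derive1 (ifs_map j));
  ifs_contracting : exists2 theta : R, theta < 1 &
    forall j x, `|derive1 (ifs_map j) x| <= theta;
  ifs_stable : forall j,
    ifs_map j @` `[ifs_lo, ifs_hi] `<=` `[ifs_lo, ifs_hi];
  ifs_prob_ge0 : forall j, 0 <= ifs_prob j;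
  ifs_prob_sum1 : \sum_(j < ifs_size) ifs_prob j = 1 }.

Definition ifs_interval (R : realType) (T : ifs R) : set R :=
  `[ifs_lo T, ifs_hi T].

Definition closed_nbhd (R : realType) (r : R) (J : set R) : set R :=
  [set x | exists2 y, J y & `|x - y| <= r].

(* Measures are compared on Borel sets only: outside them the value of a
   measure is unspecified. *)
Definition stationary (R : realType) (T : ifs R)
    (mu : probability (measurableTypeR R) R) : Prop :=
  forall A : set (measurableTypeR R), measurable A ->
    mu A = (\sum_(j < ifs_size T) (ifs_prob j)%:E *
      pushforward mu
        (ifs_map j : measurableTypeR R -> measurableTypeR R) A)%E.

Definition diffusion (R : realType) (alpha : R) (T : ifs R)
    (psi : R -> R) (x : R) : R :=
  \sum_(j < ifs_size T)
    ifs_prob j * `|derive1 (ifs_inv j) x| `^ alpha * psi (ifs_inv j x).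

Definition alpha_regular (R : realType) (alpha : R)
    (mu : probability (measurableTypeR R) R) : Prop :=
  exists C : R, forall (rho x : R), 0 < rho ->
    (mu (ball x rho) < (C * rho `^ alpha)%:E)%E.

(* Main.v *)
(* By stationarity and bounded distortion of the inverse branches g_j,
     mu (B_rho x) <= \sum_j p_j mu (B_{rho_j} (g_j x)),
   with rho_j = rho |g_j' x| (1 + D rho^eps).
   Let W rho = rho^alpha exp (- K rho^eps).  Since rho_j >= q rho with q > 1,
   for K large the exponential absorbs the distortion factor:
   W rho_j <= |g_j' x|^alpha W rho.  Hence a bound
     mu (B_rho x) <= C psi(x) W rho
   passes from scales >= q rho to the scale rho, because D_alpha psi <= psi; at
   scales bounded below it holds as psi is bounded away from 0, and outside
   B_r(J) both sides vanish, mu being carried by J.  As W rho <= rho^alpha and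
   psi is bounded, this is alpha-regularity. *)

Require Import Defs.
From mathcomp Require Import all_boot all_order all_algebra.
From mathcomp Require Import all_classical all_reals all_analysis.
From mathcomp Require Import measurable_realfun.
From mathcomp Require Import ring lra.

Set Implicit Arguments.
Unset Strict Implicit.
Unset Printing Implicit Defensive.

Import Order.TTheory GRing.Theory Num.Theory.
Import numFieldNormedType.Exports.

Local Open Scope classical_set_scope.
Local Open Scope ring_scope.

(** * Mean value estimates and distortion of an inverse branch *)

Lemma MVT_norm (R : realType) (f : R -> R) (x y : R) :
  (forall z, derivable f z 1) ->
  exists2 z, `|z - x| <= `|y - x| & f y - f x = derive1 f z * (y - x).
Proof.
move=> df.
have fc a b : {within `[a, b], continuous f}.
  by apply: derivable_within_continuous => z _; exact: df.
have fd (z : R) : is_derive z 1 f (derive1 f z).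
  by rewrite derive1E; apply: derivableP; exact: df.
have [xy|yx] := leP x y.
  have [z] := MVT_segment xy (fun z _ => fd z) (fc x y).
  rewrite in_itv/= => /andP[xz zy] fz; exists z => //.
  by rewrite !ger0_norm ?subr_ge0// lerB.
have [z] := MVT_segment (ltW yx) (fun z _ => fd z) (fc y x).
rewrite in_itv/= => /andP[yz zx] fz; exists z.
  by rewrite !ler0_norm ?subr_le0// ?(ltW yx)// lerN2 lerB.
by rewrite -[LHS]opprB fz -mulrN opprB.
Qed.

Lemma C1_diffeo_derive1 (R : realType) (f g : R -> R) (x : R) :
  is_C1_diffeo f g -> derive1 f (g x) * derive1 g x = 1.
Proof.
move=> [_ fg [df _] [dg _]].
rewrite -derive1_comp//.
have -> : f \o g = id by apply/funext => y /=; exact: fg.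
exact: derive1_id.
Qed.

Lemma C1_diffeo_derive1_neq0 (R : realType) (f g : R -> R) (x : R) :
  is_C1_diffeo f g -> derive1 g x != 0.
Proof.
move=> /(C1_diffeo_derive1 x) fg1; apply/eqP => g0; move: fg1.
by rewrite g0 mulr0 => /esym/eqP; rewrite oner_eq0.
Qed.

Lemma continuous_itv_bounded (R : realType) (h : R -> R) (a b : R) :
  continuous h -> exists L, forall x, a <= x <= b -> `|h x| <= L.
Proof.
move=> hc; have [ab|ba] := leP a b; last first.
  by exists 0 => x /andP[/le_trans /[apply]]; rewrite leNgt ba.
have nc : {within `[a, b], continuous (fun x => `|h x|)}.
  apply: continuous_subspaceT => x.
  by apply: continuous_comp; [exact: hc|exact: norm_continuous].
have [c _ hL] := EVT_max ab nc.
by exists `|h c| => x xab; apply: hL; rewrite in_itv.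
Qed.

(** By the mean value theorem a point y = g (f y) of the preimage is at distance |g' z| |f y - x|
    from g x for some z within rho of x, so it remains to compare g' z with g' x. Only f' is given
    as Hoelder, so the variation of g' is expressed through that of f'. Compactness bounds g' on
    [a - 1, b + 1], which contains every such z because rho <= 1. The conclusion is asked for all D
    above a threshold so that finitely many maps can share one D. *)
Lemma C1_diffeo_distortion (R : realType) (f g : R -> R) (eps a b : R) :
  0 < eps -> is_C1_diffeo f g -> is_hoelder eps (derive1 f) ->
  exists D0, forall D, D0 <= D -> forall x, a <= x <= b ->
    `|derive1 g x| <= D /\
    forall rho, 0 < rho <= 1 ->
      f @^-1` ball x rho `<=`
      ball (g x) (rho * `|derive1 g x| * (1 + D * rho `^ eps)).
Proof.
move=> eps0 fg [K fK].
have [fgK gfK [df fc] [dg gc]] := fg.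
have [L gL] := continuous_itv_bounded (a - 1) (b + 1) gc.
pose K' := Num.max K 0; pose L' := Num.max L 0.
have K'0 : 0 <= K' by rewrite le_max lexx orbT.
have L'0 : 0 <= L' by rewrite le_max lexx orbT.
(* The first summand bounds |g' x|. The second is the distortion coefficient: [L'] for g' z, times
   the Hoelder bound K' (L' rho)^eps for f' (g z) - f' (g x), with rho^eps taken out. *)
exists (L' + K' * L' `^ eps * L') => D hD x xab.
have {}gL z : a - 1 <= z <= b + 1 -> `|derive1 g z| <= L'.
  by move=> /gL gz; rewrite le_max gz.
have E0 : 0 <= K' * L' `^ eps * L' by rewrite !mulr_ge0// powR_ge0.
split.
  apply: le_trans hD; apply: (le_trans (gL x _)); last by rewrite lerDl.
  by move: xab; lra.
move=> rho /andP[rho0 rho1] y; rewrite /preimage/= -!ball_normE/= => fyx.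
have [z zx gE] := MVT_norm x (f y) dg.
have {}zx : `|z - x| < rho by rewrite (le_lt_trans zx)// distrC.
have zI w : `|w - x| < rho -> a - 1 <= w <= b + 1.
  by rewrite ltr_norml => /andP[? ?]; move: xab; lra.
rewrite fgK in gE; rewrite distrC gE normrM.
have g'0 := C1_diffeo_derive1_neq0 x fg.
(* f'(g w) g'(w) = 1 gives g' z = g' x (1 - g' z (f'(g z) - f'(g x))). *)
have gz : `|derive1 g z| <= `|derive1 g x| * (1 + D * rho `^ eps).
  have -> : derive1 g z = derive1 g x *
      (1 - derive1 g z * (derive1 f (g z) - derive1 f (g x))).
    have e1 := C1_diffeo_derive1 z fg; have e2 := C1_diffeo_derive1 x fg.
    move: e1 e2; set u := derive1 g z; set v := derive1 g x.
    set s := derive1 f (g z); set t := derive1 f (g x) => e1 e2.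
    have -> : v * (1 - u * (s - t)) = v - v * (s * u) + u * (t * v) by ring.
    by rewrite e1 e2 !mulr1 subrr add0r.
  rewrite normrM ler_wpM2l// (le_trans (ler_normB _ _))// normr1 lerD2l normrM.
  have [w wx gE2] := MVT_norm x z dg.
  have gzx : `|g z - g x| <= L' * rho.
    by rewrite gE2 normrM ler_pM ?gL ?zI ?(le_lt_trans wx) ?(ltW zx).
  have fzx : `|derive1 f (g z) - derive1 f (g x)| <=
      K' * (L' `^ eps * rho `^ eps).
    apply: (le_trans (fK _ _)).
    apply: (@le_trans _ _ (K' * `|g z - g x| `^ eps)).
      by rewrite ler_wpM2r ?powR_ge0// le_max lexx.
    rewrite ler_wpM2l// -powRM ?(ltW rho0)//.
    by rewrite ge0_ler_powR ?nnegrE ?(ltW eps0)// mulr_ge0// ltW.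
  apply: (@le_trans _ _ (L' * (K' * (L' `^ eps * rho `^ eps)))).
    by rewrite ler_pM// gL ?zI.
  rewrite !mulrA ler_wpM2r ?powR_ge0// (le_trans _ hD)//.
  by rewrite -[leLHS]mulrA mulrC lerDr.
rewrite (mulrC rho) mulrAC.
have gz0 : 0 < `|derive1 g z|.
  by rewrite normr_gt0 (C1_diffeo_derive1_neq0 z fg).
rewrite (@lt_le_trans _ _ (`|derive1 g z| * rho))//.
  by rewrite ltr_pM2l// distrC.
by rewrite ler_pM2r.
Qed.

(** * Common constants and the gauge inequality *)

Lemma ord_uniform_bound (R : realType) (n : nat) (m : R)
    (P : 'I_n -> R -> Prop) :
  (forall j, exists c0, forall c, c0 <= c -> P j c) ->
  exists2 c, m <= c & forall j, P j c.
Proof.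
move=> /choice[c0 c0P].
exists (\big[Num.max/m]_j c0 j); first exact: bigmax_ge_id.
by move=> j; apply: c0P; exact: le_bigmax.
Qed.

Lemma expr_unbounded (R : realType) (q x : R) :
  1 < q -> exists n, x <= q ^+ n.
Proof.
move=> q1.
have bern n : 1 + n%:R * (q - 1) <= q ^+ n.
  elim: n => [|n IHn]; first by rewrite mul0r addr0 expr0.
  rewrite exprSr (le_trans _ (ler_wpM2r _ IHn)) ?(le_trans ler01 (ltW q1))//.
  have := ler0n R n; rewrite -natr1; move: n%:R => m m0.
    have : 0 <= m * (q - 1) ^+ 2 by rewrite mulr_ge0// sqr_ge0.
    rewrite expr2; lra.
pose y := `|x| / (q - 1).
have y0 : 0 <= y by rewrite divr_ge0// subr_ge0 ltW.
exists (Num.bound y); apply: le_trans (bern _).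
have := archi_boundP y0; rewrite ltr_pdivrMr ?subr_gt0// => xy.
rewrite (le_trans (ler_norm x))// (le_trans (ltW xy))// lerDr//.
Qed.

(** The distortion factor costs (1 + c rho^eps)^alpha <= exp (alpha c rho^eps). Since rho' >= q rho,
    the exponent K rho'^eps exceeds K rho^eps by at least K (q^eps - 1) rho^eps, and the condition
    on K makes this gain cover the cost. *)
Lemma gauge_step (R : realType) (alpha eps q c K rho rho' d : R) :
  0 < alpha -> 0 < eps -> 1 < q -> 0 <= c ->
  alpha * c <= K * (q `^ eps - 1) -> 0 <= K ->
  0 < rho -> q <= d ->
  rho' = rho * d * (1 + c * rho `^ eps) ->
  rho' `^ alpha * expR (- (K * rho' `^ eps)) <=
  d `^ alpha * (rho `^ alpha * expR (- (K * rho `^ eps))).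
Proof.
move=> alpha0 eps0 q1 c0 cK K0 rho0 qd rho'E.
have re0 := powR_ge0 rho eps.
have q0 : 0 < q by rewrite (lt_trans ltr01).
have d0 : 0 < d by rewrite (lt_le_trans q0).
have e0 : 0 <= c * rho `^ eps by rewrite mulr_ge0.
have u0 : 0 <= 1 + c * rho `^ eps by rewrite addr_ge0.
have rd0 : 0 <= rho * d by rewrite mulr_ge0// ltW.
rewrite {1}rho'E powRM// powRM ?(ltW rho0) ?(ltW d0)//.
rewrite [rho `^ alpha * _]mulrC -!mulrA ler_wpM2l ?powR_ge0//.
rewrite ler_wpM2l ?powR_ge0//.
have uE : (1 + c * rho `^ eps) `^ alpha <= expR (c * rho `^ eps * alpha).
  rewrite expRM ge0_ler_powR ?nnegrE ?expR_ge0 ?(ltW alpha0)//.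
  exact: expR_ge1Dx.
have rr' : rho `^ eps * q `^ eps <= rho' `^ eps.
  rewrite -powRM ?(ltW rho0) ?(ltW q0)//.
  have rq : rho * q <= rho'.
    rewrite rho'E (@le_trans _ _ (rho * d))// ?ler_pM2l//.
    by rewrite ler_peMr// lerDl.
  have rq0 : 0 <= rho * q by rewrite mulr_ge0 ?(ltW rho0) ?(ltW q0).
  by rewrite ge0_ler_powR ?nnegrE ?(ltW eps0)// (le_trans rq0).
apply: (le_trans (ler_wpM2r (expR_ge0 _) uE)).
rewrite -expRD ler_expR.
move: re0 cK rr'; set s := rho `^ eps; set t := q `^ eps; set s' := rho' `^ eps.
move=> s0 cK ss'.
have h1 : K * (s * t) <= K * s' by rewrite ler_wpM2l.
have h2 : s * (alpha * c) <= s * (K * (t - 1)) by rewrite ler_wpM2l.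
lra.
Qed.

(** * Expansion factor and neighbourhoods of the interval *)

Lemma ifs_expansion (R : realType) (T : ifs R) :
  exists2 q : R, 1 < q &
    forall (j : 'I_(ifs_size T)) x, `|derive1 (ifs_map j) x| <= q^-1.
Proof.
have [theta theta1 dT] := ifs_contracting T.
(* The maximum with 1/2 makes the contraction rate visibly positive, hence invertible, while keeping
   it below 1. *)
pose t := Num.max theta 2^-1.
have t0 : 0 < t by rewrite lt_max invr_gt0 ltr0n orbT.
have t1 : t < 1 by rewrite gt_max theta1 invf_lt1 ?ltr1n.
exists t^-1; first by rewrite invf_gt1.
by move=> j x; rewrite invrK (le_trans (dT j x))// le_max lexx.
Qed.

Lemma closed_nbhd_itv (R : realType) (lo hi s : R) :
  lo <= hi -> 0 <= s ->
  closed_nbhd s `[lo, hi]%classic = `[lo - s, hi + s]%classic.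
Proof.
move=> lohi s0; apply/seteqP; split => x /=.
  by move=> [y]; rewrite /= !in_itv/= ler_norml; lra.
rewrite in_itv/= => /andP[xlo xhi].
have [xl|lx] := leP x lo.
  by exists lo; rewrite /= ?in_itv/= ?lexx// ler_norml; lra.
have [hx|xh] := leP hi x.
  by exists hi; rewrite /= ?in_itv/= ?lexx ?lohi// ler_norml; lra.
by exists x; rewrite /= ?in_itv/= ?subrr ?normr0// !ltW.
Qed.

Lemma measurable_closed_nbhd (R : realType) (T : ifs R) (s : R) :
  0 <= s ->
  measurable (closed_nbhd s (ifs_interval T) : set (measurableTypeR R)).
Proof.
by move=> s0; rewrite /ifs_interval closed_nbhd_itv ?ifs_lo_hi.
Qed.

Lemma ifs_map_closed_nbhd (R : realType) (T : ifs R) (q s : R)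
    (j : 'I_(ifs_size T)) x :
  (forall (j : 'I_(ifs_size T)) x, `|derive1 (ifs_map j) x| <= q^-1) ->
  closed_nbhd s (ifs_interval T) x ->
  closed_nbhd (s / q) (ifs_interval T) (ifs_map j x).
Proof.
move=> dT [y yJ xy]; exists (ifs_map j y).
  by apply: ((@ifs_stable _ T j)); exists y.
have [_ _ [df _] _] := ifs_diffeo j.
have [z _ ->] := MVT_norm y x df.
by rewrite normrM mulrC ler_pM.
Qed.

Lemma ifs_map_measurable (R : realType) (T : ifs R) (j : 'I_(ifs_size T))
    (A : set (measurableTypeR R)) :
  measurable A ->
  measurable ((ifs_map j @^-1` A) : set (measurableTypeR R)).
Proof.
move=> mA; rewrite -[X in measurable X]setTI.
apply: continuous_measurable_fun => //.
have [_ _ [df _] _] := ifs_diffeo j.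
by move=> x; apply: differentiable_continuous; exact/derivable1_diffP.
Qed.

(** * Support of the stationary measure *)

Lemma stationary_le (R : realType) (T : ifs R)
    (mu : probability (measurableTypeR R) R)
    (A : set (measurableTypeR R))
    (B : 'I_(ifs_size T) -> set (measurableTypeR R)) :
  stationary T mu -> measurable A -> (forall j, measurable (B j)) ->
  (forall j, ifs_map j @^-1` A `<=` B j) ->
  (mu A <= \sum_(j < ifs_size T) (ifs_prob j)%:E * mu (B j))%E.
Proof.
move=> hmu mA mB AB; rewrite hmu//; apply: lee_sum => j _.
rewrite lee_wpmul2l ?lee_fin ?ifs_prob_ge0//.
by rewrite /pushforward le_measure ?inE//; exact: ifs_map_measurable.
Qed.

Lemma stationary_ge (R : realType) (T : ifs R)
    (mu : probability (measurableTypeR R) R)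
    (A B : set (measurableTypeR R)) :
  stationary T mu -> measurable A -> measurable B ->
  (forall j : 'I_(ifs_size T), B `<=` ifs_map j @^-1` A) -> (mu B <= mu A)%E.
Proof.
move=> hmu mA mB BA; rewrite (hmu A)//.
(* As the weights sum to 1, mu B is a weighted mean of copies of itself, which can be compared term
   by term with stationarity at A. *)
have -> : mu B = (\sum_(j < ifs_size T) (ifs_prob j)%:E * mu B)%E.
  rewrite -ge0_sume_distrl; last by move=> j _; rewrite lee_fin ifs_prob_ge0.
  by rewrite sumEFin ifs_prob_sum1 mul1e.
apply: lee_sum => j _; rewrite lee_wpmul2l ?lee_fin ?ifs_prob_ge0//.
by rewrite /pushforward le_measure ?inE//; exact: ifs_map_measurable.
Qed.

(** Let F n be the neighbourhood of radius s q^n. Every map sends F (n+1) into F n, so stationarity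
    gives mu (F (n+1)) <= mu (F n). But the F n increase to the whole line, so their masses tend to
    1, and already F 0 has mass 1. *)
Lemma stationary_closed_nbhd (R : realType) (T : ifs R)
    (mu : probability (measurableTypeR R) R) (s : R) :
  stationary T mu -> 0 < s ->
  mu (closed_nbhd s (ifs_interval T) : set (measurableTypeR R)) = 1%E.
Proof.
move=> hmu s0.
have [q q1 dT] := ifs_expansion T.
have q0 : 0 < q by rewrite (lt_trans ltr01).
pose F n : set (measurableTypeR R) :=
  closed_nbhd (s * q ^+ n) (ifs_interval T).
have sq0 n : 0 <= s * q ^+ n by rewrite mulr_ge0 ?exprn_ge0// ltW.
have mF n : measurable (F n).
  exact: measurable_closed_nbhd.
have FU : \bigcup_n F n = setT.
  apply/seteqP; split => // x _.
  have [n xn] := expr_unbounded (`|x - ifs_lo T| / s) q1.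
  exists n => //; exists (ifs_lo T).
    by rewrite /ifs_interval /= in_itv/= lexx ifs_lo_hi.
  by rewrite mulrC -ler_pdivrMr.
have muF n : (mu (F n.+1) <= mu (F n))%E.
  apply: (stationary_ge hmu) => // j x /(ifs_map_closed_nbhd j dT).
  by rewrite exprSr mulrA mulfK// gt_eqF.
have muF0 n : (mu (F n) <= mu (F 0%N))%E.
  by elim: n => // n IHn; exact: le_trans (muF n) IHn.
have : mu \o F @ \oo --> mu (\bigcup_n F n).
  apply: nondecreasing_cvg_mu => //; first by rewrite FU.
  apply/nondecreasing_seqP => n; apply/subsetPset => x [y Jy xy].
  exists y => //; rewrite (le_trans xy)// ler_pM2l//.
  by rewrite ler_eXn2l.
rewrite FU probability_setT => cF.
apply/eqP; rewrite eq_le probability_le1; last first.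
  by have := mF 0%N; rewrite /F expr0 mulr1.
have := cvg_lim (@ereal_hausdorff R) cF => <- /=.
apply: lime_le; first by apply/cvg_ex; exists 1%E.
apply: nearW => n; have := muF0 n.
by rewrite [X in (_ <= mu X)%E]/F expr0 mulr1.
Qed.

(** Such a ball misses B_{r/2}(J), which has full mass; r is split evenly between the ball and this
    neighbourhood. *)
Lemma stationary_ball0 (R : realType) (T : ifs R)
    (mu : probability (measurableTypeR R) R) (r rho x : R) :
  stationary T mu -> 0 < r -> rho <= r / 2 ->
  ~ closed_nbhd r (ifs_interval T) x ->
  mu (ball x rho : set (measurableTypeR R)) = 0%E.
Proof.
move=> hmu r0 rhor xJ.
have r20 : 0 < r / 2 by rewrite divr_gt0.
have mJ : measurable
    (closed_nbhd (r / 2) (ifs_interval T) : set (measurableTypeR R)).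
  by apply: measurable_closed_nbhd; exact: ltW.
have mC : mu (~` (closed_nbhd (r / 2) (ifs_interval T)
    : set (measurableTypeR R))) = 0%E.
  by rewrite probability_setC// stationary_closed_nbhd// subee.
apply: (subset_measure0 _ _ _ mC); rewrite ?inE//.
- exact: measurable_ball.
- exact: measurableC.
move=> y; rewrite -ball_normE/= => xy [z Jz yz]; apply: xJ; exists z => //.
rewrite -(subrKA y) (le_trans (ler_normD _ _))//.
rewrite [leRHS](splitr r) lerD//.
exact: le_trans (ltW xy) rhor.
Qed.

(** * Induction on scales *)

Lemma ifs_distortion (R : realType) (T : ifs R) (r : R) : 0 <= r ->
  exists eps q D : R, [/\ 0 < eps, 1 < q, 1 <= D &
    forall (j : 'I_(ifs_size T)) x, closed_nbhd r (ifs_interval T) x ->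
      q <= `|derive1 (ifs_inv j) x| <= D /\
      forall rho, 0 < rho <= 1 ->
        ifs_map j @^-1` ball x rho `<=`
        ball (ifs_inv j x)
          (rho * `|derive1 (ifs_inv j) x| * (1 + D * rho `^ eps))].
Proof.
move=> r0; have [eps eps0 hT] := ifs_hoelder T.
have [q q1 dT] := ifs_expansion T.
have [D D1 DT] := ord_uniform_bound 1 (fun j => C1_diffeo_distortion
  (ifs_lo T - r) (ifs_hi T + r) eps0 (ifs_diffeo j) (hT j)).
exists eps, q, D; split => // j x.
rewrite /ifs_interval closed_nbhd_itv ?ifs_lo_hi// => xJ.
have [gD gB] := DT j x xJ; split => //; rewrite gD andbT.
have q0 : 0 < q by rewrite (lt_trans ltr01).
(* From |f'(g x)| |g' x| = 1 and |f'| <= 1/q follows the lower bound q <= |g' x|. *)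
have := C1_diffeo_derive1 x (ifs_diffeo j) => /(congr1 Num.norm).
rewrite normrM normr1 => fg1.
by rewrite -[leLHS]mulr1 -fg1 mulrA ler_piMl// -ler_pdivlMl// mulr1.
Qed.

Lemma stationary_ball_le (R : realType) (T : ifs R)
    (mu : probability (measurableTypeR R) R) (alpha r c : R) (psi : R -> R) :
  stationary T mu -> 0 < alpha -> 0 < r -> 0 < c ->
  (forall x, 0 <= psi x) ->
  (forall x, closed_nbhd r (ifs_interval T) x -> c <= psi x) ->
  (forall x, closed_nbhd r (ifs_interval T) x ->
    diffusion alpha T psi x <= psi x) ->
  exists C R1 : R, [/\ 0 <= C, 0 < R1 & forall rho x, 0 < rho <= R1 ->
    (mu (ball x rho : set (measurableTypeR R)) <=
      (C * psi x * rho `^ alpha)%:E)%E].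
Proof.
move=> hmu alpha0 r0 c0 psi0 cpsi Dpsi.
have [eps [q [D [eps0 q1 D1 dist]]]] := ifs_distortion T (ltW r0).
have q0 : 0 < q by rewrite (lt_trans ltr01).
have D0 : 0 < D by rewrite (lt_le_trans ltr01).
have one_eps : 1 `^ eps = 1 by rewrite powR1.
have qe1 : 0 < q `^ eps - 1.
  rewrite subr_gt0 -[ltLHS]one_eps gt0_ltr_powR// nnegrE//.
  exact: ltW.
pose K := alpha * D / (q `^ eps - 1).
have K0 : 0 <= K by rewrite divr_ge0// ?mulr_ge0// ltW.
(* Radii up to r/2 have mass 0 around points outside B_r(J); radii up to 1 are those covered by the
   distortion estimate. *)
pose R1 := Num.min (r / 2) 1.
have R10 : 0 < R1 by rewrite lt_min divr_gt0//=.
have R1r : R1 <= r / 2 by rewrite ge_min lexx.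
have R11 : R1 <= 1 by rewrite ge_min lexx orbT.
have DD0 : 0 < D * (1 + D) by rewrite mulr_gt0// addr_gt0.
(* For rho < rho0 the new radii satisfy rho_j <= rho D (1 + D) <= R1, so they stay in the range of
   the induction. *)
pose rho0 := R1 / (D * (1 + D)).
have rho00 : 0 < rho0 by rewrite divr_gt0.
pose W rho := rho `^ alpha * expR (- (K * rho `^ eps)).
have W0 rho : 0 <= W rho by rewrite mulr_ge0 ?powR_ge0 ?expR_ge0.
(* A lower bound for [W] on [rho0, R1], each factor being taken at its worse end. With C = 1 / (c w)
   the claimed bound is at least 1 at these radii for centres in B_r(J), so it holds because mu is a
   probability. *)
pose w := rho0 `^ alpha * expR (- (K * R1 `^ eps)).
have w0 : 0 < w by rewrite mulr_gt0 ?powR_gt0 ?expR_gt0.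
pose C := (c * w)^-1.
have C0 : 0 <= C by rewrite invr_ge0 ltW// mulr_gt0.
have outside rho1 x1 : rho1 <= R1 -> ~ closed_nbhd r (ifs_interval T) x1 ->
    (mu (ball x1 rho1 : set (measurableTypeR R)) <=
      (C * (psi x1 * W rho1))%:E)%E.
  move=> rho1R xJ; rewrite (stationary_ball0 hmu r0 _ xJ) ?(le_trans rho1R)//.
  by rewrite lee_fin; exact: mulr_ge0 C0 (mulr_ge0 (psi0 x1) (W0 rho1)).
have large rho1 x1 : rho0 <= rho1 <= R1 ->
    closed_nbhd r (ifs_interval T) x1 ->
    (mu (ball x1 rho1 : set (measurableTypeR R)) <=
      (C * (psi x1 * W rho1))%:E)%E.
  move=> /andP[rho01 rho1R] xJ.
  have rho1_ge0 : 0 <= rho1 by rewrite (le_trans _ rho01)// ltW.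
  rewrite (le_trans (probability_le1 _ _)) ?lee_fin//.
    exact: measurable_ball.
  rewrite ler_pdivlMl ?(mulr_gt0 c0 w0)// mulr1.
  apply: (ler_pM (ltW c0) (ltW w0) (cpsi _ xJ)).
  apply: ler_pM; [exact: powR_ge0|exact: expR_ge0| |].
    by rewrite ge0_ler_powR ?nnegrE// ltW.
  rewrite ler_expR lerN2 ler_wpM2l//.
  by rewrite ge0_ler_powR ?nnegrE// ltW.
(* Here n is a number of multiplications by q sufficient to bring rho up to rho0. The claim covers
   every x on the line, since g_j x may leave B_r(J). *)
have claim n : forall rho x, 0 < rho <= R1 -> rho0 <= rho * q ^+ n ->
    (mu (ball x rho : set (measurableTypeR R)) <= (C * (psi x * W rho))%:E)%E.
  elim: n => [|n IHn] rho x /andP[rho_gt0 rhoR] rhon.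
    have [xJ|nxJ] := pselect (closed_nbhd r (ifs_interval T) x);
      last exact: outside.
    by apply: large => //; rewrite rhoR andbT -[leRHS]mulr1 -(expr0 q).
  have [xJ|nxJ] := pselect (closed_nbhd r (ifs_interval T) x);
    last exact: outside.
  have [rho_ge|rho_lt] := leP rho0 rho; first by apply: large; rewrite ?rho_ge.
  pose d j := `|derive1 (ifs_inv (i := T) j) x|.
  pose rho' j := rho * d j * (1 + D * rho `^ eps).
  have rho1 : 0 < rho <= 1 by rewrite rho_gt0 (le_trans rhoR).
  have re : 0 <= rho `^ eps <= 1.
    rewrite powR_ge0/= -one_eps ge0_ler_powR ?nnegrE// ?(ltW rho_gt0)//.
      exact: ltW.
    by case/andP: rho1.
  have qd j : q <= d j <= D := (dist j x xJ).1.
  have d_gt0 j : 0 < d j by case/andP: (qd j) => /(lt_le_trans q0).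
  have rho'q j : rho * q <= rho' j.
    case/andP: (qd j) => qdj _; case/andP: re => re0 _.
    rewrite (@le_trans _ _ (rho * d j))// ?ler_pM2l//.
    by rewrite ler_peMr ?(ltW (mulr_gt0 _ _))// lerDl mulr_ge0// ltW.
  have rho'R j : rho' j <= R1.
    case/andP: (qd j) => _ dD; case/andP: re => re0 re1.
    have -> : R1 = rho0 * D * (1 + D).
      by rewrite -mulrA /rho0 divfK// gt_eqF.
    have u0 : 0 <= 1 + D * rho `^ eps by rewrite addr_ge0// mulr_ge0// ltW.
    have rd0 : 0 <= rho * d j by rewrite ltW// mulr_gt0.
    apply: ler_pM => //.
      by apply: ler_pM => //; exact: ltW.
    by rewrite lerD2l ler_piMr// ltW.
  have rho'_gt0 j : 0 < rho' j by rewrite (lt_le_trans _ (rho'q j)) ?mulr_gt0.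
  have mB j : measurable
      (ball (ifs_inv j x) (rho' j) : set (measurableTypeR R)).
    exact: measurable_ball.
  apply: le_trans (stationary_le hmu (measurable_ball x rho) mB _) _.
    by move=> j; exact: (dist j x xJ).2.
  apply: (@le_trans _ _ (\sum_(j < ifs_size T)
    (ifs_prob j * (C * (psi (ifs_inv j x) * (d j `^ alpha * W rho))))%:E)%E).
    (* The induction hypothesis is used at radius rho_j and centre g_j x, where rho_j >= q rho
       absorbs one factor q; [gauge_step] then turns W rho_j into |g_j' x|^alpha W rho. *)
    apply: lee_sum => j _; rewrite EFinM lee_wpmul2l ?lee_fin ?ifs_prob_ge0//.
    apply: (le_trans (IHn (rho' j) _ _ _)).
    - by rewrite rho'_gt0 rho'R.
    - rewrite (le_trans rhon)// exprS mulrA ler_wpM2r ?exprn_ge0 ?(ltW q0)//.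
    rewrite lee_fin ler_wpM2l// ler_wpM2l//.
    apply: (@gauge_step _ _ _ q D) => //.
    - exact: ltW.
    - by rewrite divfK ?gt_eqF.
    - by case/andP: (qd j).
  rewrite sumEFin lee_fin.
  apply: (@le_trans _ _ (C * (diffusion alpha T psi x * W rho))).
    rewrite mulr_suml mulr_sumr ler_sum// => j _.
    by rewrite le_eqVlt; apply/orP; left; apply/eqP; rewrite /d; ring.
  apply: ler_wpM2l; first exact: C0.
  by apply: ler_wpM2r; [exact: W0|exact: Dpsi].
exists C, R1; split => // rho x rhoR.
have [n rn] := expr_unbounded (rho0 / rho) q1.
have [rho_gt0 _] := andP rhoR.
apply: (le_trans (claim n rho x rhoR _)).
  by rewrite mulrC -ler_pdivrMr.
rewrite lee_fin -mulrA ler_wpM2l// ler_wpM2l//.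
by rewrite ler_piMr ?powR_ge0// -expR0 ler_expR oppr_le0 mulr_ge0// powR_ge0.
Qed.

Theorem theorem1p23 (R : realType) (T : ifs R)
    (mu : probability (measurableTypeR R) R) (hmu : stationary T mu)
    (alpha : R) (halpha : 0 < alpha)
    (hpsi : exists (r : R) (psi : R -> R),
      [/\ 0 < r,
          forall x, 0 <= psi x,
          forall x, ~ closed_nbhd r (ifs_interval T) x -> psi x = 0,
          exists c M : R, 0 < c /\
            (forall x, closed_nbhd r (ifs_interval T) x -> c <= psi x <= M)
        & forall x, closed_nbhd r (ifs_interval T) x ->
            diffusion alpha T psi x < psi x]) :
  alpha_regular alpha mu.
Proof.
have [r [psi [r0 psi0 psiJ [c [M [c0 cM]]] Dpsi]]] := hpsi.
have [C [R1 [C0 R10 CR1]]] := stationary_ball_le hmu halpha r0 c0 psi0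
  (fun x xJ => proj1 (andP (cM x xJ))) (fun x xJ => ltW (Dpsi x xJ)).
(* The interval is nonempty, and at its left end 0 < c <= psi <= M. *)
have M0 : 0 <= M.
  have /andP[/(le_trans (ltW c0))] : c <= psi (ifs_lo T) <= M.
    apply: cM; exists (ifs_lo T); last by rewrite subrr normr0 ltW.
    by rewrite /ifs_interval /= in_itv/= lexx ifs_lo_hi.
  exact: le_trans.
have psiM x : psi x <= M.
  have [/cM/andP[]//|/psiJ ->//] := pselect (closed_nbhd r (ifs_interval T) x).
have E0 : 0 <= (R1 `^ alpha)^-1 by rewrite invr_ge0 powR_ge0.
(* [C * M] serves the radii up to [R1]; for larger ones R1^(-alpha) rho^alpha >= 1 >= mu. The added
   1 makes the inequality strict. *)
exists (C * M + (R1 `^ alpha)^-1 + 1) => rho x rho0.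
have ra0 : 0 < rho `^ alpha by rewrite powR_gt0.
have [rhoR|Rrho] := leP rho R1.
  apply: (le_lt_trans (CR1 rho x _)); first by rewrite rho0.
  rewrite lte_fin ltr_pM2r//.
  rewrite (@le_lt_trans _ _ (C * M))// ?ler_wpM2l//.
  by rewrite -addrA ltrDl ltr_wpDl.
apply: (@le_lt_trans _ _ 1%E).
  by apply: probability_le1; exact: measurable_ball.
rewrite lte_fin (@le_lt_trans _ _ ((R1 `^ alpha)^-1 * rho `^ alpha))//.
  rewrite ler_pdivlMl ?powR_gt0// mulr1 ge0_ler_powR ?nnegrE//; exact: ltW.
by rewrite ltr_pM2r// addrAC ltrDr ltr_wpDl// mulr_ge0.
Qed.
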